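(* Let $\mathcal{C}$ be a triangulated category and $\xi$ a proper class of triangles in $\mathcal{C}$ such that $\mathcal{C}$ has enough $\xi$-projectives. Then $\mathcal{G}^{n}\mathcal{P}(\xi)=\mathcal{GP}(\xi)$ for every integer $n\geq 1$.
   Context: Let $\mathcal{C}=(\mathcal{C},\Sigma,\Delta)$ be a triangulated category with suspension $\Sigma$ and class of distinguished triangles $\Delta$. **Base change.** For a triangle $A\xrightarrow{f}B\xrightarrow{g}C\xrightarrow{h}\Sigma A$ in $\Delta$ and a morphism $\varepsilon:E\to C$, the octahedral axiom gives a base change diagram: triangles $A\xrightarrow{f'}G\xrightarrow{g'}E\xrightarrow{h'}\Sigma A$, $M\to G\xrightarrow{\beta}B\to\Sigma M$ and $M\to E\xrightarrow{\varepsilon}C\to\Sigma M$ in $\Delta$, such that $(1_A,\beta,\varepsilon)$ is a morphism of triangles from $A\to G\to E\to\Sigma A$ to $A\to B\to C\to\Sigma A$ (so $h'=h\varepsilon$) and $(1_M,g',g)$ is a morphism of triangles from $M\to G\to B\to\Sigma M$ to $M\to E\to C\to\Sigma M$. **Cobase change.** Dually, for a triangle $A\xrightarrow{f}B\xrightarrow{g}C\xrightarrow{h}\Sigma A$ and a morphism $\alpha:A\to D$, there is a triangle $D\xrightarrow{f'}F\xrightarrow{g'}C\xrightarrow{h'}\Sigma D$ with $h'=(\Sigma\alpha)h$, fitting into the dual diagram. **Proper class.** A class $\xi\subseteq\Delta$ is a proper class of triangles if: (1) $\xi$ is closed under isomorphisms and finite coproducts and contains all split triangles; (2) $\xi$ is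 closed under suspensions (if $A\xrightarrow{f}B\xrightarrow{g}C\xrightarrow{h}\Sigma A$ is in $\xi$ and $i\in\mathbb{Z}$, then $\Sigma^iA\xrightarrow{(-1)^i\Sigma^if}\Sigma^iB\xrightarrow{(-1)^i\Sigma^ig}\Sigma^iC\xrightarrow{(-1)^i\Sigma^ih}\Sigma^{i+1}A$ is in $\xi$), and saturated (in every base change diagram, if $M\to E\to C\to\Sigma M$ and $A\to G\to E\to\Sigma A$ are in $\xi$, then $A\to B\to C\to\Sigma A$ is in $\xi$); (3) $\xi$ is closed under base change ($A\to B\to C\to\Sigma A$ in $\xi$ implies $A\to G\to E\to\Sigma A$ in $\xi$) and under cobase change ($A\to B\to C\to\Sigma A$ in $\xi$ implies $D\to F\to C\to\Sigma D$ in $\xi$). **$\xi$-projectives.** An object $P$ is $\xi$-projective if for every triangle $A\to B\to C\to\Sigma A$ in $\xi$ the sequence $0\to\mathrm{Hom}_{\mathcal{C}}(P,A)\to\mathrm{Hom}_{\mathcal{C}}(P,B)\to\mathrm{Hom}_{\mathcal{C}}(P,C)\to0$ is exact; $\mathcal{P}(\xi)$ is the full subcategory of $\xi$-projective objects. $\mathcal{C}$ has enough $\xi$-projectives if for every object $A$ there is a triangle $K\to P\to A\to\Sigma K$ in $\xi$ with $P\in\mathcal{P}(\xi)$. **Hom-exactness.** For a full additive subcategory $\mathcal{X}$, a triangle $A\to B\to C\to\Sigma A$ in $\xi$ is $\mathrm{Hom}_{\mathcal{C}}(-,\mathcal{X})$-exact if $0\to\mathrm{Hom}_{\mathcal{C}}(C,X)\to\mathrm{Hom}_{\mathcal{C}}(B,X)\to\mathrm{Hom}_{\mathcal{C}}(A,X)\to0$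 is exact for every $X\in\mathcal{X}$. **The operation $\mathcal{G}$.** For a full additive subcategory $\mathcal{X}$ of $\mathcal{C}$, $\mathcal{G}(\mathcal{X})$ is the full subcategory of objects $A$ for which there exist, for all $n\in\mathbb{Z}$, $\mathrm{Hom}_{\mathcal{C}}(-,\mathcal{X})$-exact triangles $K_{n+1}\to X_n\to K_n\to\Sigma K_{n+1}$ in $\xi$ with $X_n\in\mathcal{X}$ and $K_0=A$. The objects of $\mathcal{GP}(\xi):=\mathcal{G}(\mathcal{P}(\xi))$ are called $\xi$-Gorenstein projective. Set $\mathcal{G}^0\mathcal{P}(\xi)=\mathcal{P}(\xi)$, $\mathcal{G}^1\mathcal{P}(\xi)=\mathcal{GP}(\xi)$ and inductively $\mathcal{G}^{n+1}\mathcal{P}(\xi)=\mathcal{G}^n(\mathcal{GP}(\xi))$ for $n\ge1$, where $\mathcal{G}^n$ denotes the $n$-fold iterate of $\mathcal{G}$. *)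

(* Defs.v *)
From mathcomp Require Import all_boot all_order all_algebra.

Set Implicit Arguments.
Unset Strict Implicit.
Unset Printing Implicit Defensive.

Import GRing.Theory.
Local Open Scope ring_scope.

(** * Preadditive categories and additive functors *)

Record preadditive := Preadditive {
  obj :> Type;
  mor : obj -> obj -> zmodType;
  idm : forall A : obj, mor A A;
  cmp : forall A B C : obj, mor B C -> mor A B -> mor A C;
  cmp1m : forall (A B : obj) (f : mor A B), cmp (idm B) f = f;
  cmpm1 : forall (A B : obj) (f : mor A B), cmp f (idm A) = f;
  cmpA : forall (A B C D : obj) (h : mor C D) (g : mor B C) (f : mor A B),
    cmp h (cmp g f) = cmp (cmp h g) f;
  cmpDl : forall (A B C : obj) (g g' : mor B C) (f : mor A B),
    cmp (g + g') f = cmp g f + cmp g' f;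
  cmpDr : forall (A B C : obj) (g : mor B C) (f f' : mor A B),
    cmp g (f + f') = cmp g f + cmp g f'
}.

Arguments mor {p} A B.
Arguments idm {p} A.
Arguments cmp {p A B C} g f.

Notation "g \oc f" := (cmp g f) (at level 40, left associativity).

Record add_functor (C : preadditive) := AddFunctor {
  fobj :> C -> C;
  fmap : forall A B : C, mor A B -> mor (fobj A) (fobj B);
  fmap_id : forall A : C, fmap (idm A) = idm (fobj A);
  fmap_cmp : forall (A B D : C) (g : mor B D) (f : mor A B),
    fmap (g \oc f) = fmap g \oc fmap f;
  fmapD : forall (A B : C) (f g : mor A B), fmap (f + g) = fmap f + fmap g
}.

Arguments fmap {C} F {A B} f : rename.

Definition is_iso (C : preadditive) (A B : C) (f : mor A B) : Prop :=
  exists g : mor B A, g \oc f = idm A /\ f \oc g = idm B.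

Definition is_zero (C : preadditive) (Z : C) : Prop :=
  forall A : C, (forall f : mor Z A, f = 0) /\ (forall f : mor A Z, f = 0).

(** The family [inj] exhibits [S] as the coproduct of [X 0, ..., X (n-1)]. *)
Definition is_coproduct (C : preadditive) (n : nat) (X : 'I_n -> C) (S : C)
    (inj : forall i, mor (X i) S) : Prop :=
  forall (Y : C) (u : forall i, mor (X i) Y),
    exists! v : mor S Y, forall i, v \oc inj i = u i.

Definition is_biproduct (C : preadditive) (A B S : C)
    (i1 : mor A S) (i2 : mor B S) (p1 : mor S A) (p2 : mor S B) : Prop :=
  [/\ p1 \oc i1 = idm A, p2 \oc i2 = idm B, p1 \oc i2 = 0, p2 \oc i1 = 0
    & i1 \oc p1 + i2 \oc p2 = idm S].

(** The case [n = 0] provides a zero object. *)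
Definition has_finite_coproducts (C : preadditive) : Prop :=
  forall (n : nat) (X : 'I_n -> C),
    exists (S : C) (inj : forall i, mor (X i) S), is_coproduct inj.

(** * Suspension

    The suspension is an additive adjoint autoequivalence with a chosen
    quasi-inverse.  A strict automorphism is the case where the unit and the
    counit are identities; the weaker notion avoids equalities between objects
    such as [sus (desus A) = A]. *)
Record suspended := Suspended {
  scat :> preadditive;
  sus : add_functor scat;
  desus : add_functor scat;
  eta : forall A : scat, mor A (desus (sus A));
  etaV : forall A : scat, mor (desus (sus A)) A;
  eps : forall A : scat, mor (sus (desus A)) A;
  epsV : forall A : scat, mor A (sus (desus A));
  etaK : forall A : scat, etaV A \oc eta A = idm A;
  etaVK : forall A : scat, eta A \oc etaV A = idm (desus (sus A));
  epsK : forall A : scat, epsV A \oc eps A = idm (sus (desus A));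
  epsVK : forall A : scat, eps A \oc epsV A = idm A;
  eta_nat : forall (A B : scat) (f : mor A B),
    eta B \oc f = fmap desus (fmap sus f) \oc eta A;
  eps_nat : forall (A B : scat) (f : mor A B),
    eps B \oc fmap sus (fmap desus f) = f \oc eps A;
  eps_eta : forall A : scat, eps (sus A) \oc fmap sus (eta A) = idm (sus A);
  eta_eps : forall A : scat,
    fmap desus (eps A) \oc eta (desus A) = idm (desus A)
}.

Arguments sus {s}.
Arguments desus {s}.
Arguments etaV {s} A.
Arguments epsV {s} A.

Section IterFunctor.
Variables (C : preadditive) (F : add_functor C).

Fixpoint iter_obj (n : nat) (A : C) : C :=
  if n is m.+1 then F (iter_obj m A) else A.

Fixpoint iter_map (n : nat) (A B : C) (f : mor A B) :
    mor (iter_obj n A) (iter_obj n B) :=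
  match n with
  | 0%N => f
  | m.+1 => fmap F (iter_map m f)
  end.

End IterFunctor.

Section SuspensionPowers.
Variable C : suspended.

(** [Negz n] stands for [- n.+1]. *)
Definition susz (i : int) : C -> C :=
  match i with
  | Posz n => iter_obj sus n
  | Negz n => iter_obj desus n.+1
  end.

Definition susz_map (i : int) (A B : C) (f : mor A B) :
    mor (susz i A) (susz i B) :=
  match i with
  | Posz n => iter_map sus n f
  | Negz n => iter_map desus n.+1 f
  end.

(** The canonical isomorphism from Sigma^i (Sigma A) to Sigma (Sigma^i A),
    an identity when the suspension is a strict automorphism. *)
Fixpoint sus_comm (n : nat) (A : C) :
    mor (iter_obj sus n (sus A)) (sus (iter_obj sus n A)) :=
  match n with
  | 0%N => idm (sus A)
  | m.+1 => fmap sus (sus_comm m A)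
  end.

Fixpoint desus_comm (n : nat) (A : C) :
    mor (iter_obj desus n (sus A)) (sus (iter_obj desus n A)) :=
  match n with
  | 0%N => idm (sus A)
  | m.+1 => epsV (iter_obj desus m A) \oc etaV (iter_obj desus m A)
              \oc fmap desus (desus_comm m A)
  end.

Definition susz_comm (i : int) (A : C) : mor (susz i (sus A)) (sus (susz i A)) :=
  match i with
  | Posz n => sus_comm n A
  | Negz n => desus_comm n.+1 A
  end.

End SuspensionPowers.

(** * Triangles *)

(** A candidate triangle [tA -> tB -> tC -> sus tA], not necessarily
    distinguished. *)
Record triangle (C : suspended) := Triangle {
  tA : C;
  tB : C;
  tC : C;
  tf : mor tA tB;
  tg : mor tB tC;
  th : mor tC (sus tA)
}.

Arguments Triangle {C tA tB tC} tf tg th.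

Section Triangles.
Variable C : suspended.
Implicit Types T : triangle C.

Definition tri_mor T T' (a : mor (tA T) (tA T')) (b : mor (tB T) (tB T'))
    (c : mor (tC T) (tC T')) : Prop :=
  [/\ b \oc tf T = tf T' \oc a,
      c \oc tg T = tg T' \oc b
    & fmap sus a \oc th T = th T' \oc c].

Definition tri_iso T T' : Prop :=
  exists (a : mor (tA T) (tA T')) (b : mor (tB T) (tB T'))
         (c : mor (tC T) (tC T')),
    [/\ tri_mor a b c, is_iso a, is_iso b & is_iso c].

Definition rotate T : triangle C :=
  Triangle (tg T) (th T) (- fmap sus (tf T)).

(** Coproducts of triangles are formed componentwise; [sus] preserves finite
    coproducts because it is additive. *)
Definition is_tri_coproduct (n : nat) (U : 'I_n -> triangle C) T : Prop :=
  exists (a : forall i, mor (tA (U i)) (tA T))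
         (b : forall i, mor (tB (U i)) (tB T))
         (c : forall i, mor (tC (U i)) (tC T)),
    [/\ forall i, tri_mor (a i) (b i) (c i),
        is_coproduct a, is_coproduct b & is_coproduct c].

(** Isomorphic to [A -> A (+) B -> B -> sus A] with zero last map. *)
Definition split_triangle T : Prop :=
  exists (A B S : C) (i1 : mor A S) (i2 : mor B S)
         (p1 : mor S A) (p2 : mor S B),
    is_biproduct i1 i2 p1 p2 /\ tri_iso T (Triangle i1 p2 0).

Definition shift_triangle (i : int) T : triangle C :=
  Triangle (susz_map i (tf T) *~ (-1) ^ i)
           (susz_map i (tg T) *~ (-1) ^ i)
           ((susz_comm i (tA T) \oc susz_map i (th T)) *~ (-1) ^ i).

End Triangles.

(** * Triangulated categories *)

Record triangulated := Triangulated {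
  tcat :> suspended;
  distinguished : triangle tcat -> Prop;
  tr_additive : has_finite_coproducts tcat;
  tr1_iso : forall T T' : triangle tcat,
    tri_iso T T' -> distinguished T -> distinguished T';
  tr1_id : forall A Z : tcat, is_zero Z ->
    distinguished (Triangle (idm A) (0 : mor A Z) 0);
  tr1_cone : forall (A B : tcat) (f : mor A B),
    exists (D : tcat) (g : mor B D) (h : mor D (sus A)),
      distinguished (Triangle f g h);
  tr2 : forall T : triangle tcat, distinguished T <-> distinguished (rotate T);
  tr3 : forall (T T' : triangle tcat)
      (a : mor (tA T) (tA T')) (b : mor (tB T) (tB T')),
    distinguished T -> distinguished T' -> b \oc tf T = tf T' \oc a ->
    exists c : mor (tC T) (tC T'), tri_mor a b c;
  (* octahedral axiom *)
  tr4 : forall (X Y Z Q1 Q2 Q3 : tcat)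
      (f : mor X Y) (p1 : mor Y Q1) (d1 : mor Q1 (sus X))
      (g : mor Y Z) (p3 : mor Z Q3) (d3 : mor Q3 (sus Y))
      (p2 : mor Z Q2) (d2 : mor Q2 (sus X)),
    distinguished (Triangle f p1 d1) ->
    distinguished (Triangle g p3 d3) ->
    distinguished (Triangle (g \oc f) p2 d2) ->
    exists (a : mor Q1 Q2) (b : mor Q2 Q3),
      [/\ distinguished (Triangle a b (fmap sus p1 \oc d3)),
          @tri_mor tcat (Triangle f p1 d1) (Triangle (g \oc f) p2 d2)
            (idm X) g a
        & @tri_mor tcat (Triangle (g \oc f) p2 d2) (Triangle g p3 d3)
            f (idm Z) b]
}.

Arguments distinguished {t} T.

(** * Proper classes of triangles *)

Section ProperClass.
Variable C : triangulated.

(** Base change of [A -f-> B -g-> D -h-> sus A] along [e : E -> D]. *)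
Definition base_change (A B D E G M : C)
    (f : mor A B) (g : mor B D) (h : mor D (sus A)) (e : mor E D)
    (f' : mor A G) (g' : mor G E) (h' : mor E (sus A))
    (m : mor M G) (b : mor G B) (k : mor B (sus M))
    (m' : mor M E) (k' : mor D (sus M)) : Prop :=
  [/\ [/\ distinguished (Triangle f g h),
          distinguished (Triangle f' g' h'),
          distinguished (Triangle m b k)
        & distinguished (Triangle m' e k')],
      @tri_mor C (Triangle f' g' h') (Triangle f g h) (idm A) b e
    & @tri_mor C (Triangle m b k) (Triangle m' e k') (idm M) g' g].

(** Cobase change of [A -f-> B -g-> D -h-> sus A] along [a : A -> E]. *)
Definition cobase_change (A B D E F N : C)
    (f : mor A B) (g : mor B D) (h : mor D (sus A)) (a : mor A E)
    (f' : mor E F) (g' : mor F D) (h' : mor D (sus E))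
    (b : mor B F) (n : mor F N) (k : mor N (sus B))
    (n' : mor E N) (k' : mor N (sus A)) : Prop :=
  [/\ [/\ distinguished (Triangle f g h),
          distinguished (Triangle f' g' h'),
          distinguished (Triangle b n k)
        & distinguished (Triangle a n' k')],
      @tri_mor C (Triangle f g h) (Triangle f' g' h') a b (idm D)
    & @tri_mor C (Triangle a n' k') (Triangle b n k) f f' (idm N)].

Variable xi : triangle C -> Prop.

Definition closed_base_change : Prop :=
  forall (A B D E G M : C)
      (f : mor A B) (g : mor B D) (h : mor D (sus A)) (e : mor E D)
      (f' : mor A G) (g' : mor G E) (h' : mor E (sus A))
      (m : mor M G) (b : mor G B) (k : mor B (sus M))
      (m' : mor M E) (k' : mor D (sus M)),
    base_change f g h e f' g' h' m b k m' k' ->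
    xi (Triangle f g h) -> xi (Triangle f' g' h').

Definition closed_cobase_change : Prop :=
  forall (A B D E F N : C)
      (f : mor A B) (g : mor B D) (h : mor D (sus A)) (a : mor A E)
      (f' : mor E F) (g' : mor F D) (h' : mor D (sus E))
      (b : mor B F) (n : mor F N) (k : mor N (sus B))
      (n' : mor E N) (k' : mor N (sus A)),
    cobase_change f g h a f' g' h' b n k n' k' ->
    xi (Triangle f g h) -> xi (Triangle f' g' h').

Definition saturated : Prop :=
  forall (A B D E G M : C)
      (f : mor A B) (g : mor B D) (h : mor D (sus A)) (e : mor E D)
      (f' : mor A G) (g' : mor G E) (h' : mor E (sus A))
      (m : mor M G) (b : mor G B) (k : mor B (sus M))
      (m' : mor M E) (k' : mor D (sus M)),
    base_change f g h e f' g' h' m b k m' k' ->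
    xi (Triangle m' e k') -> xi (Triangle f' g' h') -> xi (Triangle f g h).

Record proper_class : Prop := ProperClass {
  pc_distinguished : forall T, xi T -> distinguished T;
  pc_iso : forall T T' : triangle C, tri_iso T T' -> xi T -> xi T';
  pc_coproduct : forall (n : nat) (U : 'I_n -> triangle C) (T : triangle C),
    (forall i, xi (U i)) -> is_tri_coproduct U T -> xi T;
  pc_split : forall T, split_triangle T -> xi T;
  pc_shift : forall (i : int) (T : triangle C), xi T -> xi (shift_triangle i T);
  pc_saturated : saturated;
  pc_base_change : closed_base_change;
  pc_cobase_change : closed_cobase_change
}.

(** * Projective and Gorenstein projective objects *)

(** Exactness of [0 -> U -> V -> W -> 0]. *)
Definition short_exact (U V W : zmodType) (a : U -> V) (b : V -> W) : Prop :=
  [/\ injective a,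
      forall v : V, b v = 0 <-> exists u : U, a u = v
    & forall w : W, exists v : V, b v = w].

Definition xi_projective (P : C) : Prop :=
  forall T : triangle C, xi T ->
    short_exact (fun u : mor P (tA T) => tf T \oc u)
                (fun v : mor P (tB T) => tg T \oc v).

Definition enough_projectives : Prop :=
  forall A : C, exists (K P : C) (f : mor K P) (g : mor P A) (h : mor A (sus K)),
    xi_projective P /\ xi (Triangle f g h).

Definition hom_exact (X : C -> Prop) (T : triangle C) : Prop :=
  forall Y : C, X Y ->
    short_exact (fun u : mor (tC T) Y => u \oc tg T)
                (fun v : mor (tB T) Y => v \oc tf T).

(** Full subcategories are given by predicates on objects. *)
Definition Gop (X : C -> Prop) (A : C) : Prop :=
  exists K XX : int -> C,
    [/\ K 0 = A,
        forall n : int, X (XX n)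
      & forall n : int,
          exists (f : mor (K (n + 1)) (XX n)) (g : mor (XX n) (K n))
                 (h : mor (K n) (sus (K (n + 1)))),
            xi (Triangle f g h) /\ hom_exact X (Triangle f g h)].

Definition gorenstein_projective : C -> Prop := Gop xi_projective.

Definition iter_gorenstein (n : nat) : C -> Prop :=
  if n is m.+1 then iter m Gop gorenstein_projective else xi_projective.

End ProperClass.

(* Main.v *)
(* With enough projectives, a distinguished triangle lies in xi iff its
   connecting morphism h is phantom (killed by all maps from projectives), and
   it is moreover Hom(-, P(xi))-exact iff h is killed by all maps to Q and to
   sus Q with Q projective.  These h form a two-sided ideal, so by the
   octahedral axiom the Hom(-, P(xi))-exact triangles of xi behave like the
   conflations of an exact category: they admit base and cobase changes, and
   deflations and inflations compose.  A two-sided horseshoe argument shows that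
   GP(xi) is closed under extensions.  For A in G(GP(xi)), base change along the
   given triangles and composition with projective covers of objects of GP(xi)
   produce triangles A' -> P -> A in which A' is again an extension of an object
   of G(GP(xi)) by an object of GP(xi), and this can be iterated; dually on the
   right.  *)
Require Import Defs.
From mathcomp Require Import all_boot all_order all_algebra.
From Stdlib Require Import IndefiniteDescription.

Set Implicit Arguments.
Unset Strict Implicit.
Unset Printing Implicit Defensive.

Import GRing.Theory.
Local Open Scope ring_scope.

(** * Arithmetic of morphisms in a preadditive category *)

Section Preadditive.
Variable C : preadditive.

Lemma cmp0l (A B D : C) (f : mor A B) : (0 : mor B D) \oc f = 0.
Proof. by apply: (addrI (0 \oc f)); rewrite -cmpDl !addr0. Qed.

Lemma cmp0r (A B D : C) (g : mor B D) : g \oc (0 : mor A B) = 0.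
Proof. by apply: (addrI (g \oc 0)); rewrite -cmpDr !addr0. Qed.

Lemma cmpNl (A B D : C) (g : mor B D) (f : mor A B) : (- g) \oc f = - (g \oc f).
Proof. by apply: (addrI (g \oc f)); rewrite -cmpDl !subrr cmp0l. Qed.

Lemma cmpNr (A B D : C) (g : mor B D) (f : mor A B) : g \oc (- f) = - (g \oc f).
Proof. by apply: (addrI (g \oc f)); rewrite -cmpDr !subrr cmp0r. Qed.

Lemma cmpBl (A B D : C) (g g' : mor B D) (f : mor A B) :
  (g - g') \oc f = g \oc f - g' \oc f.
Proof. by rewrite cmpDl cmpNl. Qed.

Lemma cmpBr (A B D : C) (g : mor B D) (f f' : mor A B) :
  g \oc (f - f') = g \oc f - g \oc f'.
Proof. by rewrite cmpDr cmpNr. Qed.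

Lemma is_iso_idm (A : C) : is_iso (idm A).
Proof. by exists (idm A); rewrite cmp1m. Qed.

Lemma is_iso_opp_idm (A : C) : is_iso (- idm A).
Proof. by exists (- idm A); rewrite cmpNl cmpNr cmp1m opprK. Qed.

Lemma fmap0 (F : add_functor C) (A B : C) : fmap F (0 : mor A B) = 0.
Proof. by apply: (addrI (fmap F (0 : mor A B))); rewrite -fmapD !addr0. Qed.

(** The empty coproduct is initial, so its identity is 0 and it is terminal as well. *)
Lemma exists_zero : has_finite_coproducts C -> exists Z : C, is_zero Z.
Proof.
move=> cop; have X : 'I_0 -> C by case.
have [Z [inj copZ]] := cop 0%N X; exists Z.
have uniqZ (Y : C) (f g : mor Z Y) : f = g.
  have u (i : 'I_0) : mor (X i) Y by case: i.
  have [v [_ uv]] := copZ Y u.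
  by rewrite -(uv f) ?(uv g) // => -[].
move=> A; split=> f; first exact: uniqZ.
by rewrite -(cmp1m f) (uniqZ _ (idm Z) 0) cmp0l.
Qed.

Lemma biproductC (A B S : C) (i1 : mor A S) (i2 : mor B S)
    (p1 : mor S A) (p2 : mor S B) :
  is_biproduct i1 i2 p1 p2 -> is_biproduct i2 i1 p2 p1.
Proof. by case=> *; split=> //; rewrite addrC. Qed.

End Preadditive.

(** * The suspension is fully faithful *)

Section Suspension.
Variable C : suspended.

Lemma sus_faithful (A B : C) (f g : mor A B) :
  fmap sus f = fmap sus g -> f = g.
Proof.
move=> fg; have E (k : mor A B) :
    k = etaV B \oc (fmap desus (fmap sus k) \oc eta A).
  by rewrite -eta_nat cmpA etaK cmp1m.
by rewrite (E f) (E g) fg.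
Qed.

Lemma desus_faithful (A B : C) (f g : mor A B) :
  fmap desus f = fmap desus g -> f = g.
Proof.
move=> fg; have E (k : mor A B) :
    k = eps B \oc fmap sus (fmap desus k) \oc epsV A.
  by rewrite eps_nat -cmpA epsVK cmpm1.
by rewrite (E f) (E g) fg.
Qed.

Lemma sus_full (A B : C) (u : mor (sus A) (sus B)) :
  exists f : mor A B, fmap sus f = u.
Proof.
exists (etaV B \oc fmap desus u \oc eta A); apply: desus_faithful.
have E (k : mor A B) : fmap desus (fmap sus k) = eta B \oc k \oc etaV A.
  by rewrite eta_nat -cmpA etaVK cmpm1.
by rewrite E !cmpA etaVK cmp1m -cmpA etaVK cmpm1.
Qed.

End Suspension.

(** * Factorizations, octahedra and base change for distinguished triangles *)

Section Distinguished.
Variable C : triangulated.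

Lemma distinguished_oppfg (X Y Z : C) (f : mor X Y) (g : mor Y Z)
    (h : mor Z (sus X)) :
  distinguished (Triangle f g h) -> distinguished (Triangle (- f) (- g) h).
Proof.
apply: tr1_iso; exists (idm X), (- idm Y), (idm Z).
split; [split|exact: is_iso_idm|exact: is_iso_opp_idm|exact: is_iso_idm] => /=.
- by rewrite cmpm1 cmpNl cmp1m.
- by rewrite cmp1m cmpNl cmpNr cmpm1 opprK.
- by rewrite fmap_id cmp1m cmpm1.
Qed.

Lemma distinguished_oppgh (X Y Z : C) (f : mor X Y) (g : mor Y Z)
    (h : mor Z (sus X)) :
  distinguished (Triangle f g h) -> distinguished (Triangle f (- g) (- h)).
Proof.
apply: tr1_iso; exists (idm X), (idm Y), (- idm Z).
split; [split|exact: is_iso_idm|exact: is_iso_idm|exact: is_iso_opp_idm] => /=.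
- by rewrite cmpm1 cmp1m.
- by rewrite cmpNl cmp1m cmpm1.
- by rewrite fmap_id cmp1m cmpNl cmpNr cmpm1 opprK.
Qed.

(** Three rotations suspend a triangle and negate all three maps; two of the signs are absorbed by
    an isomorphism. *)
Lemma distinguished_desus (X Y Z : C) (f : mor X Y) (g : mor Y Z)
    (h : mor Z (sus X)) :
  distinguished (Triangle (fmap sus f) (fmap sus g) (- fmap sus h)) ->
  distinguished (Triangle f g h).
Proof. by move=> /distinguished_oppfg D; do 3![apply/tr2]. Qed.

Lemma complete_morphism (X Y Z X' Y' Z' : C)
    (f : mor X Y) (g : mor Y Z) (h : mor Z (sus X))
    (f' : mor X' Y') (g' : mor Y' Z') (h' : mor Z' (sus X'))
    (a : mor X X') (b : mor Y Y') :
  distinguished (Triangle f g h) -> distinguished (Triangle f' g' h') ->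
  b \oc f = f' \oc a ->
  exists c : mor Z Z', c \oc g = g' \oc b /\ fmap sus a \oc h = h' \oc c.
Proof.
move=> D D' E; have [c [_ E1 E2]] :=
  @tr3 C (Triangle f g h) (Triangle f' g' h') a b D D' E.
by exists c.
Qed.

Lemma distinguished_cmp_fg (X Y Z : C) (f : mor X Y) (g : mor Y Z)
    (h : mor Z (sus X)) :
  distinguished (Triangle f g h) -> g \oc f = 0.
Proof.
move=> D; have [O zO] := exists_zero (@tr_additive C).
have [c [E _]] := complete_morphism (tr1_id X zO) D (erefl (f \oc idm X)).
by rewrite -E cmp0r.
Qed.

Lemma distinguished_cmp_gh (X Y Z : C) (f : mor X Y) (g : mor Y Z)
    (h : mor Z (sus X)) :
  distinguished (Triangle f g h) -> h \oc g = 0.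
Proof. by move=> /tr2 /distinguished_cmp_fg. Qed.

Lemma distinguished_cmp_hf (X Y Z : C) (f : mor X Y) (g : mor Y Z)
    (h : mor Z (sus X)) :
  distinguished (Triangle f g h) -> fmap sus f \oc h = 0.
Proof.
move=> /tr2 /distinguished_cmp_gh /= /eqP.
by rewrite cmpNl oppr_eq0 => /eqP.
Qed.

Lemma factor_through_f (X Y Z W : C) (f : mor X Y) (g : mor Y Z)
    (h : mor Z (sus X)) (u : mor W Y) :
  distinguished (Triangle f g h) -> g \oc u = 0 ->
  exists w : mor W X, u = f \oc w.
Proof.
move=> D gu; have [O zO] := exists_zero (@tr_additive C).
(* A morphism from the rotated trivial triangle on [W] to the rotated given one has third component
   [sus W] to [sus X], which desuspends to the required lift. *)
have D1 := (tr2 _).1 (tr1_id W zO).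
have D2 := (tr2 _).1 D.
have [|c [_ E]] := complete_morphism (a := u) (b := 0) D1 D2.
  by rewrite cmp0l.
have [w Ew] := sus_full c; exists w; apply: sus_faithful.
rewrite fmap_cmp Ew; apply: oppr_inj; rewrite -cmpNl -E fmap_id.
by rewrite cmpNr cmpm1.
Qed.

Lemma factor_through_g (X Y Z W : C) (f : mor X Y) (g : mor Y Z)
    (h : mor Z (sus X)) (u : mor W Z) :
  distinguished (Triangle f g h) -> h \oc u = 0 ->
  exists w : mor W Y, u = g \oc w.
Proof. by move=> /tr2; exact: factor_through_f. Qed.

Lemma factor_through_h (X Y Z W : C) (f : mor X Y) (g : mor Y Z)
    (h : mor Z (sus X)) (u : mor W (sus X)) :
  distinguished (Triangle f g h) -> fmap sus f \oc u = 0 ->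
  exists w : mor W Z, u = h \oc w.
Proof.
move=> /tr2 D fu; apply: (factor_through_g D).
by rewrite /= cmpNl fu oppr0.
Qed.

Lemma extend_along_g (X Y Z W : C) (f : mor X Y) (g : mor Y Z)
    (h : mor Z (sus X)) (u : mor Y W) :
  distinguished (Triangle f g h) -> u \oc f = 0 ->
  exists w : mor Z W, u = w \oc g.
Proof.
move=> D uf; have [O zO] := exists_zero (@tr_additive C).
(* Rotating this triangle puts [sus O] where [tr1_id] has [O]; both are zero objects, so the zero
   map between them is an isomorphism. *)
have D1 : distinguished (Triangle (0 : mor O W) (idm W) (0 : mor W (sus O))).
  apply/tr2; have D0 := tr1_id W zO.
  have := D0; apply: tr1_iso => /=.
  exists (idm W), (idm W), (0 : mor O (sus O)); split.
  - by split=> /=; rewrite ?cmp1m ?cmpm1 ?cmp0l ?cmp0r //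
      ?fmap0 ?oppr0 ?cmp0l ?cmp0r.
  - exact: is_iso_idm.
  - exact: is_iso_idm.
  - exists 0; rewrite cmp0l cmp0r; split.
      by rewrite ((zO O).1 (idm O)).
    have E : idm (sus O) = 0 :> mor (sus O) (sus O).
      by rewrite -fmap_id ((zO O).1 (idm O)) fmap0.
    by rewrite E.
have [|c [E _]] := complete_morphism (a := 0) (b := u) D D1.
  by rewrite cmp0l uf.
by exists c; rewrite E cmp1m.
Qed.

Lemma extend_along_h (X Y Z W : C) (f : mor X Y) (g : mor Y Z)
    (h : mor Z (sus X)) (u : mor Z W) :
  distinguished (Triangle f g h) -> u \oc g = 0 ->
  exists w : mor (sus X) W, u = w \oc h.
Proof. by move=> /tr2; exact: extend_along_g. Qed.

Lemma extend_along_sus_f (X Y Z W : C) (f : mor X Y) (g : mor Y Z)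
    (h : mor Z (sus X)) (u : mor (sus X) W) :
  distinguished (Triangle f g h) -> u \oc h = 0 ->
  exists w : mor (sus Y) W, u = w \oc fmap sus f.
Proof.
move=> /tr2 D uh; have [w ->] := extend_along_h D uh.
by exists (- w); rewrite /= cmpNr cmpNl.
Qed.

Lemma extend_along_f (X Y Z W : C) (f : mor X Y) (g : mor Y Z)
    (h : mor Z (sus X)) (u : mor X W) :
  distinguished (Triangle f g h) -> fmap sus u \oc h = 0 ->
  exists w : mor Y W, u = w \oc f.
Proof.
move=> D uh; have [w Ew] := extend_along_sus_f D uh.
have [v Ev] := sus_full w; exists v; apply: sus_faithful.
by rewrite fmap_cmp Ev.
Qed.

Lemma exists_fiber (Y Z : C) (g : mor Y Z) :
  exists (X : C) (f : mor X Y) (h : mor Z (sus X)),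
    distinguished (Triangle f g h).
Proof.
have [Q [p [d D]]] := tr1_cone g.
(* The fiber is the desuspended cone; the sign cancels the one introduced by [rotate]. *)
have [f Ef] := sus_full (- (d \oc eps Q)).
exists (desus Q), f, (epsV Q \oc p); apply/tr2; rewrite /rotate /= Ef.
move: D; apply: tr1_iso; exists (idm Y), (idm Z), (epsV Q); split.
- split=> /=; rewrite ?cmp1m ?cmpm1 // opprK fmap_id cmp1m.
  by rewrite -cmpA epsVK cmpm1.
- exact: is_iso_idm.
- exact: is_iso_idm.
- by exists (eps Q); rewrite epsVK epsK.
Qed.

(** The octahedral axiom phrased with fibers instead of cones: [tr4] is applied to the rotated
    triangles and its maps are desuspended. *)
Lemma fiber_octahedron (X Y Z Q1 Q3 : C)
    (m1 : mor Q1 X) (f : mor X Y) (p1 : mor Y (sus Q1))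
    (m3 : mor Q3 Y) (g : mor Y Z) (p3 : mor Z (sus Q3)) :
  distinguished (Triangle m1 f p1) -> distinguished (Triangle m3 g p3) ->
  exists (Q2 : C) (m2 : mor Q2 X) (p2 : mor Z (sus Q2))
    (a : mor Q1 Q2) (b : mor Q2 Q3),
    [/\ distinguished (Triangle m2 (g \oc f) p2),
        distinguished (Triangle a b (p1 \oc m3)),
        m2 \oc a = m1 /\ m3 \oc b = f \oc m2
      & fmap sus a \oc p1 = p2 \oc g /\ fmap sus b \oc p2 = p3].
Proof.
move=> D1 D3; have [Q2 [m2 [p2 D2]]] := exists_fiber (g \oc f).
have [a' [b' [D /= [_ E1 E2] /= [_ E3 E4]]]] :=
  @tr4 C _ _ _ _ _ _ _ _ _ _ _ _ _ _
    ((tr2 _).1 D1) ((tr2 _).1 D3) ((tr2 _).1 D2).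
have [a Ea] := sus_full a'; have [b Eb] := sus_full b'.
exists Q2, m2, p2, a, b; split=> //.
- apply: distinguished_desus; rewrite Ea Eb fmap_cmp -cmpNr.
  exact: D.
- split; apply: sus_faithful; apply: oppr_inj; rewrite !fmap_cmp.
    by rewrite Ea -cmpNl -E2 fmap_id cmp1m.
  by rewrite Eb -cmpNl -E4 cmpNr.
- by rewrite Ea Eb E1 E3 cmpm1.
Qed.

Lemma exists_base_change (A B D E M : C)
    (f : mor A B) (g : mor B D) (h : mor D (sus A))
    (m' : mor M E) (e : mor E D) (k' : mor D (sus M)) :
  distinguished (Triangle f g h) -> distinguished (Triangle m' e k') ->
  exists (G : C) (f' : mor A G) (g' : mor G E) (m : mor M G) (b : mor G B),
    base_change f g h e f' g' (h \oc e) m b (k' \oc g) m' k'.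
Proof.
move=> D1 D2.
(* [G] is the fiber of the composite [h \oc e], so the base change is the octahedron on that
   composite. *)
have [G [g' [p [m [b [Dp Dk [E1 E2] [E3 E4]]]]]]] :=
  fiber_octahedron D2 ((tr2 _).1 D1).
have [f' Ef'] := sus_full (- p).
exists G, f', g', m, b; split.
- split=> //; apply/tr2; rewrite /rotate /= Ef' opprK; exact: Dp.
- split=> /=; rewrite ?cmpm1 ?fmap_id ?cmp1m //.
  by apply: sus_faithful; rewrite fmap_cmp Ef' cmpNr E4 /= opprK.
- by split=> /=; rewrite ?cmpm1 ?fmap_id ?cmp1m.
Qed.

Lemma zero_connecting_biproduct (A B D : C) (f : mor A B) (g : mor B D) :
  distinguished (Triangle f g 0) ->
  exists (s : mor D B) (r : mor B A), is_biproduct f s r g.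
Proof.
move=> T.
have [|s0 /esym Es] := factor_through_g (u := idm D) T; first by rewrite cmp0l.
have [|r /esym Er] := extend_along_f (u := idm A) T; first by rewrite cmp0r.
have gf := distinguished_cmp_fg T.
pose s := s0 - f \oc (r \oc s0).
(* Subtracting [f \oc (r \oc s0)] keeps a section of [g] and makes it orthogonal to the retraction
   [r]. *)
have gs : g \oc s = idm D by rewrite cmpBr !cmpA gf !cmp0l subr0.
have rs : r \oc s = 0 by rewrite cmpBr !cmpA Er cmp1m subrr.
exists s, r; split=> //.
(* The defect [e] kills [f], hence factors through [g]; since it also kills [s], that factor is
   0. *)
pose e := idm B - (f \oc r + s \oc g).
have [|w Ew] := extend_along_g (u := e) T.
  rewrite cmpBl cmpDl -!cmpA gf Er cmpm1 cmp1m cmp0r addr0; exact: subrr.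
have w0 : w = 0.
  rewrite -(cmpm1 w) -gs cmpA -Ew cmpBl cmpDl -!cmpA gs rs cmpm1 cmp1m cmp0r.
  by rewrite add0r subrr.
by move: Ew; rewrite w0 cmp0l => /eqP; rewrite subr_eq0 => /eqP <-.
Qed.

End Distinguished.

(** * Coinductive description of the operation G *)

Section ExactTriangles.
Variables (C : triangulated) (xi : triangle C -> Prop).

(** Only the objects are recorded, because the later constructions use no more than the existence of
    such a triangle. *)
Definition exact_triangle (X : C -> Prop) (A B D : C) : Prop :=
  exists (f : mor A B) (g : mor B D) (h : mor D (sus A)),
    xi (Triangle f g h) /\ hom_exact X (Triangle f g h).

Lemma exact_triangle_sub (X X' : C -> Prop) (A B D : C) :
  (forall Y, X' Y -> X Y) -> exact_triangle X A B D -> exact_triangle X' A B D.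
Proof.
move=> sX [f [g [h [T E]]]]; exists f, g, h; split=> // Y /sX; exact: E.
Qed.

Lemma serial_sequence (W : C -> Prop) (R : C -> C -> Prop) (A : C) :
  W A -> (forall B, W B -> exists2 B', W B' & R B B') ->
  exists s : nat -> C, s 0%N = A /\ forall n, R (s n) (s n.+1).
Proof.
move=> WA stepW.
have [F FP] : exists F : {B | W B} -> {B | W B},
    forall B, R (sval B) (sval (F B)).
  apply: (functional_choice (fun B B' => R (sval B) (sval B'))) => -[B WB] /=.
  by have [B' WB' RB] := stepW B WB; exists (exist _ B' WB').
by exists (fun n => sval (iter n F (exist _ A WA))); split=> // n; apply: FP.
Qed.

(** Coinduction principle: invariants [Wl] and [Wr], preserved by one step to the left and to the
    right, yield two half-infinite sequences that are glued at [A]. *)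
Lemma Gop_coind (X Wl Wr : C -> Prop) (A : C) : Wl A -> Wr A ->
  (forall B, Wl B -> exists2 B', Wl B' &
     exists2 Y, X Y & exact_triangle X B' Y B) ->
  (forall B, Wr B -> exists2 B', Wr B' &
     exists2 Y, X Y & exact_triangle X B Y B') ->
  Gop xi X A.
Proof.
move=> WlA WrA stepl stepr.
have [l [l0 lP]] := serial_sequence WlA stepl.
have [r [r0 rP]] := serial_sequence WrA stepr.
(* Index 0 belongs to [l]; since [r 0 = l 0 = A], the right half starts at [r 1] in degree -1. *)
pose K (i : int) := match i with Posz n => l n | Negz n => r n.+1 end.
have tri (n : int) : exists Y, X Y /\ exact_triangle X (K (n + 1)) Y (K n).
  case: n => [n|[|n]].
  - by have [Y ? ?] := lP n; exists Y; rewrite -PoszD addn1.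
  - by have [Y ? ?] := rP 0%N; exists Y; rewrite /= l0 -r0.
  - by have [Y ? ?] := rP n.+1; exists Y; rewrite /= subn1.
have [XX XXP] := functional_choice _ tri.
by exists K, XX; split=> // n; have [] := XXP n.
Qed.

Lemma Gop_step (X : C -> Prop) (A : C) : Gop xi X A ->
  (exists2 B, Gop xi X B & exists2 Y, X Y & exact_triangle X B Y A) /\
  (exists2 B, Gop xi X B & exists2 Y, X Y & exact_triangle X A Y B).
Proof.
move=> [K [XX [<- XXP tri]]].
(* Every term of the sequence is again in G(X): reindex by [i]. *)
have GK (i : int) : Gop xi X (K i).
  exists (fun n => K (n + i)), (fun n => XX (n + i)).
  by split=> [||n]; rewrite ?add0r // addrAC; apply: tri.
split; [exists (K 1) | exists (K (-1))] => //.
  by exists (XX 0) => //; have := tri 0; rewrite add0r.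
by exists (XX (-1)) => //; have := tri (-1); rewrite addNr.
Qed.

(** * Split triangles and Hom-exactness in a proper class *)

Hypothesis hxi : proper_class xi.

Lemma biproduct_xi (A B S : C) (i1 : mor A S) (i2 : mor B S)
    (p1 : mor S A) (p2 : mor S B) :
  is_biproduct i1 i2 p1 p2 -> xi (Triangle i1 p2 0).
Proof.
move=> bi; apply: (pc_split hxi); exists A, B, S, i1, i2, p1, p2; split=> //.
exists (idm A), (idm S), (idm B).
split; try exact: is_iso_idm.
by split; rewrite /= ?cmp1m ?cmpm1 ?cmp0r ?cmp0l.
Qed.

Lemma xi_zero_connecting (A B D : C) (f : mor A B) (g : mor B D) :
  distinguished (Triangle f g 0) -> xi (Triangle f g 0).
Proof. by move=> /zero_connecting_biproduct[s [r]]; exact: biproduct_xi. Qed.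

(* The connecting morphism [h] governs exactness: [Hom(-, Y)] is short exact on
   the triangle iff [h] is killed by all maps [sus A -> Y] and
   [sus A -> sus Y]. *)
Lemma hom_exactP (X : C -> Prop) (A B D : C)
    (f : mor A B) (g : mor B D) (h : mor D (sus A)) :
  distinguished (Triangle f g h) ->
  hom_exact X (Triangle f g h) <->
  forall Y, X Y -> (forall v : mor (sus A) Y, v \oc h = 0) /\
    (forall v : mor (sus A) (sus Y), v \oc h = 0).
Proof.
move=> T; split=> E Y XY.
  have [/= inj _ surj] := E Y XY; split=> v.
    apply: inj => /=.
    by rewrite -cmpA (distinguished_cmp_gh T) cmp0r cmp0l.
  have [u <-] := sus_full v; have [w <-] := surj u.
  by rewrite fmap_cmp -cmpA (distinguished_cmp_hf T) cmp0r.
have [E1 E2] := E Y XY; split=> /= [u u' uu'|v|w].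
- have [|v Ev] := extend_along_h (u := u - u') T.
    by rewrite cmpBl uu' subrr.
  by apply/eqP; rewrite -subr_eq0 Ev E1.
- split=> [/(extend_along_g T)[w ->]|[u <-]]; first by exists w.
  by rewrite -cmpA (distinguished_cmp_fg T) cmp0r.
- by have [v ->] := extend_along_f T (E2 (fmap sus w)); exists v.
Qed.

Lemma exact_triangle_biproduct (X : C -> Prop) (A B S : C) (i1 : mor A S)
    (i2 : mor B S) (p1 : mor S A) (p2 : mor S B) :
  is_biproduct i1 i2 p1 p2 -> exact_triangle X A S B.
Proof.
move=> bi; have T := biproduct_xi bi; exists i1, p2, 0; split=> //.
by apply/(hom_exactP _ (pc_distinguished hxi T)) => Y _; split=> v; apply: cmp0r.
Qed.

Lemma sub_Gop (X : C -> Prop) (A : C) : X A -> Gop xi X A.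
Proof.
move=> XA; have [Z zZ] := exists_zero (@tr_additive C).
have bi0 (B : C) (zB : is_zero B) : is_biproduct (idm A) (0 : mor B A) (idm A) 0.
  split; rewrite ?cmp1m ?cmp0l ?cmp0r ?addr0 //.
  by rewrite ((zB B).1 (idm B)).
(* Split triangles alternate between [A] and a zero object, always with middle term [A]. *)
pose W B := B = A \/ is_zero B.
apply: (@Gop_coind X W W); rewrite /W; try by left.
- move=> B [->|zB].
    exists Z; first by right.
    exists A => //; exact: exact_triangle_biproduct (biproductC (bi0 Z zZ)).
  exists A; first by left.
  exists A => //; exact: exact_triangle_biproduct (bi0 B zB).
- move=> B [->|zB].
    exists Z; first by right.
    exists A => //; exact: exact_triangle_biproduct (bi0 Z zZ).
  exists A; first by left.
  exists A => //; exact: exact_triangle_biproduct (biproductC (bi0 B zB)).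
Qed.

(** * Connecting morphisms of exact triangles *)

Hypothesis enough : enough_projectives xi.
Local Notation proj := (xi_projective xi).
Local Notation extri := (exact_triangle proj).

Definition phantom (A B : C) (h : mor A B) : Prop :=
  forall P, proj P -> forall p : mor P A, h \oc p = 0.

Lemma xi_phantom (A B D : C) (f : mor A B) (g : mor B D) (h : mor D (sus A)) :
  xi (Triangle f g h) -> phantom h.
Proof.
move=> T P projP p; have [/= _ _ surj] := projP _ T.
have [v <-] := surj p.
by rewrite cmpA (distinguished_cmp_gh (pc_distinguished hxi T)) cmp0l.
Qed.

(* Base change along a projective cover of [D] splits the triangle, so
   saturation applies. *)
Lemma phantom_xi (A B D : C) (f : mor A B) (g : mor B D) (h : mor D (sus A)) :
  distinguished (Triangle f g h) -> phantom h -> xi (Triangle f g h).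
Proof.
move=> T ph; have [M [P [m' [e [k' [projP Te]]]]]] := enough D.
have [G [f' [g' [m [b bc]]]]] :=
  exists_base_change T (pc_distinguished hxi Te).
apply: (pc_saturated hxi bc Te).
case: bc => -[_ + _ _] _ _; rewrite (ph P projP e).
exact: xi_zero_connecting.
Qed.

(** For a distinguished triangle, the phantom condition on the connecting morphism says that it lies
    in [xi], and the remaining two give Hom-exactness against projectives. *)
Definition good (A B : C) (h : mor A B) : Prop :=
  phantom h /\ forall Q, proj Q ->
    (forall v : mor B Q, v \oc h = 0) /\ (forall v : mor B (sus Q), v \oc h = 0).

Lemma good_cmpl (A B D : C) (g : mor B D) (h : mor A B) :
  good h -> good (g \oc h).
Proof.
move=> [ph co]; split=> [P projP p|Q /co[co1 co2]].
  by rewrite -cmpA ph // cmp0r.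
by split=> v; rewrite cmpA.
Qed.

Lemma good_cmpr (A B D : C) (h : mor B D) (f : mor A B) :
  good h -> good (h \oc f).
Proof.
move=> [ph co]; split=> [P projP p|Q /co[co1 co2]].
  by rewrite -cmpA ph.
by split=> v; rewrite cmpA ?co1 ?co2 cmp0l.
Qed.

Lemma exact_triangleP (A B D : C) :
  extri A B D <-> exists (f : mor A B) (g : mor B D) (h : mor D (sus A)),
    distinguished (Triangle f g h) /\ good h.
Proof.
split=> -[f [g [h [T E]]]]; exists f, g, h.
  have T' := pc_distinguished hxi T; split=> //.
  by split; [exact: xi_phantom T | apply/(hom_exactP _ T')].
by split; [exact: phantom_xi T E.1 | apply/(hom_exactP _ T); exact: E.2].
Qed.

(** * Exact triangles as conflations *)

(** Both new connecting morphisms, [h \oc e] and [k' \oc g], are composites with a good one. *)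
Lemma extri_base_change (A B D E M : C) : extri A B D -> extri M E D ->
  exists2 G, extri A G E & extri M G B.
Proof.
move=> /exact_triangleP[f [g [h [T gh]]]] /exact_triangleP[m' [e [k' [T' gk]]]].
have [G [f' [g' [m [b [[_ T1 T2 _] _ _]]]]]] := exists_base_change T T'.
exists G; apply/exact_triangleP.
  by exists f', g', (h \oc e); split=> //; apply: good_cmpr.
by exists m, b, (k' \oc g); split=> //; apply: good_cmpr.
Qed.

Lemma extri_cobase_change (A B D E N : C) : extri A B D -> extri A E N ->
  exists2 F, extri E F D & extri B F N.
Proof.
move=> /exact_triangleP[f [g [h [T gh]]]] /exact_triangleP[a [n' [k' [T' gk]]]].
have T1 : distinguished (Triangle k' (fmap sus a) (fmap sus n')).
  have /distinguished_oppgh := (tr2 _).1 ((tr2 _).1 T').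
  by rewrite /= !opprK.
(* [F] is the fiber of [fmap sus a \oc h], the connecting morphism required of the cobase change. *)
have [F [m2 [p [x [y [Tp Tk _ _]]]]]] :=
  fiber_octahedron ((tr2 _).1 T) T1.
have [f' Ef'] := sus_full (- p).
exists F; apply/exact_triangleP.
  exists f', m2, (fmap sus a \oc h); split; last exact: good_cmpl.
  by apply/tr2; rewrite /rotate /= Ef' opprK; exact: Tp.
exists x, y, (- fmap sus f \oc k'); split=> //; exact: good_cmpl.
Qed.

Lemma extri_deflation_comp (M E G K A : C) : extri M E G -> extri K G A ->
  exists2 A', extri A' E A & extri M A' K.
Proof.
move=> /exact_triangleP[m [u [k [T gk]]]] /exact_triangleP[m' [v [l [T' gl]]]].
have [A' [m2 [p [a [b [Tp Tk _ [E1 E2]]]]]]] := fiber_octahedron T T'.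
exists A'; apply/exact_triangleP; last first.
  by exists a, b, (k \oc m'); split=> //; apply: good_cmpr.
(* No factorization of [p] through a good map is at hand. A map from a projective lifts along [v],
   where [p \oc v] is good by [E1]; a map [w] out of [sus A'] makes [w \oc p] factor through the
   good [l]. *)
exists m2, (v \oc u), p; split=> //; split=> [P projP q|Q projQ].
  have [w ->] := factor_through_g T' (gl.1 P projP q).
  by rewrite cmpA -E1 -cmpA gk.1 // cmp0r.
have [gk1 gk2] := gk.2 Q projQ; have [gl1 gl2] := gl.2 Q projQ.
split=> w.
- have [|w' ->] := extend_along_h (u := w \oc p) T'.
    by rewrite -cmpA -E1 cmpA gk1.
  exact: gl1.
- have [|w' ->] := extend_along_h (u := w \oc p) T'.
    by rewrite -cmpA -E1 cmpA gk2.
  exact: gl2.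
Qed.

Lemma extri_inflation_comp (A B K E M : C) : extri A B K -> extri B E M ->
  exists2 A', extri A E A' & extri K A' M.
Proof.
move=> /exact_triangleP[f [p1 [d1 [T1 g1]]]] /exact_triangleP[g [p3 [d3 [T3 g3]]]].
have [A' [p2 [d2 T2]]] := tr1_cone (g \oc f).
have [a [b [Tab /= [_ _ E1] /= [_ _ E2]]]] := tr4 T1 T3 T2.
rewrite fmap_id cmp1m in E1.
exists A'; apply/exact_triangleP; last first.
  by exists a, b, (fmap sus p1 \oc d3); split=> //; apply: good_cmpl.
(* Dually, [fmap sus f \oc d2] equals [d3 \oc b] and is good. Maps from projectives followed by [d2]
   thus factor through [d1], and test maps out of [sus A] extend along [fmap sus f]. *)
exists (g \oc f), p2, d2; split=> //; split=> [P projP q|Q projQ].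
  have [|w ->] := factor_through_h (u := d2 \oc q) T1.
    by rewrite cmpA E2 -cmpA g3.1.
  exact: g1.1.
have [g11 g12] := g1.2 Q projQ; have [g31 g32] := g3.2 Q projQ.
split=> w.
- have [w' ->] := extend_along_sus_f T1 (g11 w).
  by rewrite -cmpA E2 cmpA g31 cmp0l.
- have [w' ->] := extend_along_sus_f T1 (g12 w).
  by rewrite -cmpA E2 cmpA g32 cmp0l.
Qed.

Lemma extri_proj_right (A B P : C) : proj P -> extri A B P ->
  exists (f : mor A B) (s : mor P B) (r : mor B A) (g : mor B P),
    is_biproduct f s r g.
Proof.
move=> projP /exact_triangleP[f [g [h [T [ph _]]]]].
have h0 : h = 0 by rewrite -(cmpm1 h) ph.
rewrite h0 in T; have [s [r bi]] := zero_connecting_biproduct T.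
by exists f, s, r, g.
Qed.

Lemma extri_proj_right_swap (A B P : C) :
  proj P -> extri A B P -> extri P B A.
Proof.
move=> projP /(extri_proj_right projP)[f [s [r [g bi]]]].
exact: exact_triangle_biproduct (biproductC bi).
Qed.

Lemma extri_proj_left_swap (A B P : C) : proj P -> extri P B A -> extri A B P.
Proof.
move=> projP /exact_triangleP[f [g [h [T [_ co]]]]].
have h0 : h = 0 by rewrite -(cmp1m h) (co P projP).2.
rewrite h0 in T; have [s [r bi]] := zero_connecting_biproduct T.
exact: exact_triangle_biproduct (biproductC bi).
Qed.

Lemma extri_proj_middle (P B P' : C) :
  proj P -> proj P' -> extri P B P' -> proj B.
Proof.
move=> projP projP' /(extri_proj_right projP')[i1 [i2 [p1 [p2 bi]]]].
case: bi => [_ _ _ _ dec] T xiT.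
have decr (D : C) (u : mor B D) : u = u \oc i1 \oc p1 + u \oc i2 \oc p2.
  by rewrite -!cmpA -cmpDr dec cmpm1.
have [inj1 ex1 surj1] := projP T xiT.
have [inj2 ex2 surj2] := projP' T xiT.
split=> /= [u u' uu'|v|w].
- have e1 : u \oc i1 = u' \oc i1 by apply: inj1; rewrite /= !cmpA uu'.
  have e2 : u \oc i2 = u' \oc i2 by apply: inj2; rewrite /= !cmpA uu'.
  by rewrite (decr _ u) (decr _ u') e1 e2.
- split=> [gv|[u <-]].
    have [|u1 e1] := (ex1 (v \oc i1)).1; first by rewrite cmpA gv cmp0l.
    have [|u2 e2] := (ex2 (v \oc i2)).1; first by rewrite cmpA gv cmp0l.
    by exists (u1 \oc p1 + u2 \oc p2); rewrite cmpDr !cmpA e1 e2 -decr.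
  rewrite (decr _ (_ \oc _)) -!(cmpA _ (_ \oc u)) -!(cmpA _ u).
  have -> : tg T \oc (tf T \oc (u \oc i1)) = 0 by apply/ex1; exists (u \oc i1).
  have -> : tg T \oc (tf T \oc (u \oc i2)) = 0 by apply/ex2; exists (u \oc i2).
  by rewrite !cmp0l addr0.
- have [v1 e1] := surj1 (w \oc i1); have [v2 e2] := surj2 (w \oc i2).
  by exists (v1 \oc p1 + v2 \oc p2); rewrite cmpDr !cmpA e1 e2 -decr.
Qed.

Lemma gorenstein_projective_extension (X A Y : C) :
  Gop xi proj X -> Gop xi proj Y -> extri X A Y -> Gop xi proj A.
Proof.
move=> GX GY XAY.
pose W B := exists X Y, [/\ Gop xi proj X, Gop xi proj Y & extri X B Y].
apply: (@Gop_coind proj W W); try by exists X, Y.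
- move=> {X A Y GX GY XAY} A [X [Y [GX GY XAY]]].
  have [[X1 GX1 [P1 pP1 tX]] _] := Gop_step GX.
  have [[Y1 GY1 [P0 pP0 tY]] _] := Gop_step GY.
  have [G /(extri_proj_right_swap pP0) tG Y1GA] := extri_base_change XAY tY.
  have [E tE X1EG] := extri_base_change tG tX.
  have [A' tA tA'] := extri_deflation_comp X1EG Y1GA.
  exists A'; first by exists X1, Y1.
  by exists E => //; apply: extri_proj_middle tE.
- move=> {X A Y GX GY XAY} A [X [Y [GX GY XAY]]].
  have [_ [X1 GX1 [P0 pP0 tX]]] := Gop_step GX.
  have [_ [Y1 GY1 [P1 pP1 tY]]] := Gop_step GY.
  have [F /(extri_proj_left_swap pP0) tF AFX1] := extri_cobase_change XAY tX.
  have [E tE FEY1] := extri_cobase_change tF tY.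
  have [A' tA tA'] := extri_inflation_comp AFX1 FEY1.
  exists A'; first by exists X1, Y1.
  by exists E => //; apply: extri_proj_middle tE.
Qed.

Lemma Gop_gorenstein_projective (A : C) :
  Gop xi (gorenstein_projective xi) A <-> gorenstein_projective xi A.
Proof.
split; last exact: sub_Gop.
have stepGG B : Gop xi (gorenstein_projective xi) B ->
    (exists2 K, Gop xi (gorenstein_projective xi) K &
       exists2 X, Gop xi proj X & extri K X B) /\
    (exists2 K, Gop xi (gorenstein_projective xi) K &
       exists2 X, Gop xi proj X & extri B X K).
  move=> /Gop_step[[K GK [X GX t]] [K' GK' [X' GX' t']]].
  have sub : forall Y, proj Y -> gorenstein_projective xi Y by move=> Y /sub_Gop.
  by split; [exists K | exists K'] => //; [exists X | exists X'] => //;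
    [move: t | move: t']; apply: exact_triangle_sub sub.
move=> GA.
pose Wl B := Gop xi (gorenstein_projective xi) B \/ exists X K,
  [/\ Gop xi proj X, Gop xi (gorenstein_projective xi) K & extri X B K].
pose Wr B := Gop xi (gorenstein_projective xi) B \/ exists X K,
  [/\ Gop xi proj X, Gop xi (gorenstein_projective xi) K & extri K B X].
apply: (@Gop_coind proj Wl Wr); rewrite /Wl /Wr; try by left.
- have cover F K B : Gop xi proj F -> Gop xi (gorenstein_projective xi) K ->
      extri K F B -> exists2 B', Wl B' & exists2 P, proj P & extri B' P B.
    move=> GF GK t; have [[F' GF' [P pP tF]] _] := Gop_step GF.
    have [B' tB tB'] := extri_deflation_comp tF t.
    by exists B'; [right; exists F', K | exists P].
  move=> B [/stepGG[[K GK [X GX t]] _]|[X [K [GX GK t]]]].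
    exact: cover t.
  have [[K1 GK1 [X0 GX0 t0]] _] := stepGG K GK.
  have [F tF tB] := extri_base_change t t0.
  exact: cover (gorenstein_projective_extension GX GX0 tF) GK1 tB.
- have hull F K B : Gop xi proj F -> Gop xi (gorenstein_projective xi) K ->
      extri B F K -> exists2 B', Wr B' & exists2 P, proj P & extri B P B'.
    move=> GF GK t; have [_ [F' GF' [P pP tF]]] := Gop_step GF.
    have [B' tB tB'] := extri_inflation_comp t tF.
    by exists B'; [right; exists F', K | exists P].
  move=> B [/stepGG[_ [K GK [X GX t]]]|[X [K [GX GK t]]]].
    exact: hull t.
  have [_ [K1 GK1 [X0 GX0 t0]]] := stepGG K GK.
  have [F tF tB] := extri_cobase_change t t0.
  exact: hull (gorenstein_projective_extension GX0 GX tF) GK1 tB.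
Qed.

Lemma Gop_ext (X X' : C -> Prop) (A : C) :
  (forall B, X B <-> X' B) -> Gop xi X A -> Gop xi X' A.
Proof.
move=> XX' [K [Y [K0 XY tri]]]; exists K, Y; split=> // n; first exact/XX'.
apply: (exact_triangle_sub _ (tri n)) => B; exact: (XX' B).2.
Qed.

End ExactTriangles.

Theorem mainTheorem1 (C : triangulated) (xi : triangle C -> Prop)
    (hxi : proper_class xi) (hproj : enough_projectives xi)
    (n : nat) (hn : (1 <= n)%N) (A : C) :
  iter_gorenstein xi n A <-> gorenstein_projective xi A.
Proof.
case: n hn => // n _ /=; elim: n A => [|n IHn] A //=.
split=> [|GA].
  move=> /(Gop_ext IHn); exact: (Gop_gorenstein_projective hxi hproj A).1.
apply: (@Gop_ext _ xi (gorenstein_projective xi)).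
  by move=> B; split=> /IHn.
exact: (Gop_gorenstein_projective hxi hproj A).2.
Qed.
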